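(* Let $2\le k<l<n$ and let $w_{k,l}\in\mathfrak{S}_n$ be the element with reduced expression $$\mathbf{a}=s_ks_{k-1}\,s_{k+1}s_k\cdots s_ls_{l-1}$$ (the product of the blocks $s_js_{j-1}$ for $j=k,k+1,\dots,l$ in this order). Then the Kazhdan-Lusztig polynomial satisfies $P_{e,w_{k,l}}=F_{l-k+1}(q)$.
   Context: $\mathfrak{S}_n$ is the symmetric group with generators $s_i=(i,i+1)$, identity $e$, length function $l(\cdot)$ and Bruhat-Chevalley order $\le$. $q$-Fibonacci numbers: $F_m(q)=F_{m-1}(q)+qF_{m-2}(q)$, where $F_m(q)=0$ if $m<0$ and $F_0(q)=F_1(q)=1$. Kazhdan-Lusztig polynomials: let $\mathcal{H}$ be the algebra over $\mathbb{Q}(q^{1/2})$ with basis $T_w$ ($w\in\mathfrak{S}_n$), $T_sT_w=T_{sw}$ if $l(sw)>l(w)$, $T_s^2=(q-1)T_s+qT_e$ for each generator $s$, and let $\iota(\sum_w\alpha_wT_w)=\sum_w\overline{\alpha_w}(T_{w^{-1}})^{-1}$ with $\overline{q^{1/2}}=q^{-1/2}$. The $P_{x,w}$ are the unique polynomials in $q$ such that $C_w'=q^{-l(w)/2}\sum_{x\le w}P_{x,w}T_x$ satisfies $\iota(C_w')=C_w'$, $\deg P_{x,w}\le\frac12(l(w)-l(x)-1)$ for $x<w$, $P_{w,w}=1$, and $P_{x,w}=0$ if $x\not\le w$. *)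

(* Defs.v *)
From HB Require Import structures.
From mathcomp Require Import all_boot all_order all_fingroup all_algebra.
From mathcomp Require Import falgebra ring zify.
From Stdlib Require Import ClassicalEpsilon.
Set Implicit Arguments.
Unset Strict Implicit.
Unset Printing Implicit Defensive.
Import GroupScope GRing.Theory.
Local Open Scope group_scope.

Section SymmetricGroup.

Variable n : nat.
Implicit Types (w x y : 'S_n) (i j : 'I_n.-1).

(* Point i of {1, ..., n} is the ordinal of value i - 1.  MathComp composes
   permutations from left to right; since the s_i satisfy the same relations
   for either convention, products of words in the s_i below denote
   corresponding elements.  Outside 1 <= i < n the value 1 is junk. *)
Definition adj (i : nat) : 'S_n :=
  if (insub i.-1, insub i) is (Some a, Some b) then tperm a b else 1.

Definition gen i : 'S_n := adj i.+1.

Definition has_word w (m : nat) : bool :=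
  [exists a : m.-tuple 'I_n.-1, \prod_(i <- a) gen i == w].

Fact gen_lt1 i : i < n. Proof. by case: i => i /=; case: n => // m /ltnW. Qed.
Fact gen_lt2 i : i.+1 < n. Proof. by case: i => i /=; case: n. Qed.
Let lo i : 'I_n := Ordinal (gen_lt1 i).
Let hi i : 'I_n := Ordinal (gen_lt2 i).

Lemma genE i : gen i = tperm (Ordinal (gen_lt1 i)) (Ordinal (gen_lt2 i)).
Proof.
rewrite /gen /adj /= (insubT (fun x : nat => x < n) (gen_lt1 i)).
by rewrite (insubT (fun x : nat => x < n) (gen_lt2 i)); congr tperm; apply: val_inj.
Qed.

Lemma lohi i : lo i != hi i.
Proof. by rewrite -val_eqE /= neq_ltn ltnSn. Qed.

Lemma genK i : gen i * gen i = 1. Proof. by rewrite genE tperm2. Qed.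
Lemma genV i : (gen i)^-1 = gen i. Proof. by rewrite genE tpermV. Qed.
Lemma mulgenK i w : gen i * (gen i * w) = w.
Proof. by rewrite mulgA genK mul1g. Qed.
Lemma mulKgen i w : w * gen i * gen i = w.
Proof. by rewrite -mulgA genK mulg1. Qed.

Lemma gen_lo i : gen i (lo i) = hi i. Proof. by rewrite genE tpermL. Qed.
Lemma gen_hi i : gen i (hi i) = lo i. Proof. by rewrite genE tpermR. Qed.

Definition inversions w : {set 'I_n * 'I_n} :=
  [set p : 'I_n * 'I_n | (p.1 < p.2) && (w p.2 < w p.1)].
Let inv w := #|inversions w|.

(* A left ascent of w: w (i) < w (i + 1), in the one-line notation of w. *)
Definition ascent i w : bool :=
  w (Ordinal (gen_lt1 i)) < w (Ordinal (gen_lt2 i)).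

Lemma gen_mono i (x y : 'I_n) : x < y -> (x, y) != (lo i, hi i) ->
  gen i x < gen i y.
Proof.
rewrite genE !permE /= xpair_eqE -!val_eqE /=.
by do 4?case: eqP => ? /=; lia.
Qed.

Lemma inv_gen i w : ascent i w -> inv (gen i * w) = (inv w).+1.
Proof.
rewrite /ascent -/(lo i) -/(hi i) => asc_w.
rewrite /inv (cardsD1 (lo i, hi i)) [in RHS](cardsD1 (lo i, hi i)).
rewrite !inE /= !permM gen_lo gen_hi asc_w ltnSn ltnNge (ltnW asc_w) /= add0n.
rewrite add1n; congr S.
pose f (p : 'I_n * 'I_n) := (gen i p.1, gen i p.2).
have fK : involutive f by case=> x y; rewrite /f /= -!permM genK !perm1.
rewrite -(card_preimset (inversions w :\ (lo i, hi i)) (inv_inj fK)).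
apply: eq_card => -[x y]; rewrite !inE /= !permM.
have [lt_xy | le_yx] := ltnP x y; last first.
  rewrite andbF; apply/esym/negbTE; rewrite negb_and negbK.
  have [/eqP // | nf] /= := boolP (f (x, y) == (lo i, hi i)).
  rewrite negb_and; case: ltnP => //= lt_f.
  have := gen_mono lt_f nf; rewrite -!permM !genK !perm1.
  by rewrite ltnNge le_yx.
have [e | ne] := eqVneq (x, y) (lo i, hi i).
  by case: e => -> ->; rewrite /f /= gen_lo gen_hi ltnNge leqnSn /= andbF.
rewrite (gen_mono lt_xy ne) /=.
suff -> : f (x, y) != (lo i, hi i) by [].
apply/eqP => e; have := congr1 f e; rewrite fK /f /= gen_lo gen_hi => -[ex ey].
by move: lt_xy; rewrite ex ey ltnNge leqnSn.
Qed.

Lemma ascent_gen i w : ascent i (gen i * w) = ~~ ascent i w.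
Proof.
rewrite /ascent -/(lo i) -/(hi i) !permM gen_lo gen_hi -leqNgt [RHS]leq_eqVlt.
by rewrite val_eqE (inj_eq perm_inj) eq_sym (negbTE (lohi i)).
Qed.

Lemma inv_gen_desc i w : ~~ ascent i w -> inv w = (inv (gen i * w)).+1.
Proof. by rewrite -ascent_gen => /inv_gen; rewrite mulgenK. Qed.

Lemma le_of_ascents w : (forall i, ascent i w) -> forall x : 'I_n, x <= w x.
Proof.
move=> asc [x lt_x]; elim: x lt_x => //= x IHx lt_x.
have lt_x' : x < n.-1 by case: n lt_x.
have := asc (Ordinal lt_x'); rewrite /ascent.
have ->: Ordinal (gen_lt1 (Ordinal lt_x')) = Ordinal (ltnW lt_x).
  exact: val_inj.
have ->: Ordinal (gen_lt2 (Ordinal lt_x')) = Ordinal lt_x by exact: val_inj.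
exact/leq_ltn_trans/IHx.
Qed.

Lemma ascents_lt w : (forall i, ascent i w) ->
  forall x y : 'I_n, x < y -> w x < w y.
Proof.
move=> asc x [y lt_y] /=; elim: y lt_y => //= y IHy lt_y.
have lt_y' : y < n.-1 by case: n lt_y.
have := asc (Ordinal lt_y'); rewrite /ascent.
have ->: Ordinal (gen_lt1 (Ordinal lt_y')) = Ordinal (ltnW lt_y).
  exact: val_inj.
have ->: Ordinal (gen_lt2 (Ordinal lt_y')) = Ordinal lt_y by exact: val_inj.
move=> lt_w; rewrite ltnS leq_eqVlt => /predU1P[e|/(IHy (ltnW lt_y))].
  by apply: leq_trans lt_w; rewrite ltnS; have ->: x = Ordinal (ltnW lt_y) by apply: val_inj.
by move/ltn_trans; apply.
Qed.

Lemma ascents1 w : (forall i, ascent i w) -> w = 1.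
Proof.
move=> asc; have ascV i : ascent i w^-1.
  rewrite /ascent ltnNge leq_eqVlt val_eqE (inj_eq perm_inj) eq_sym.
  rewrite (negbTE (lohi i)) /=; apply/negP => /(ascents_lt asc).
  by rewrite !permKV ltnNge leqnSn.
apply/permP=> x; rewrite perm1; apply/val_inj/eqP; rewrite eqn_leq.
rewrite (le_of_ascents asc) andbT.
by have := le_of_ascents ascV (w x); rewrite permK.
Qed.

Lemma inv_word (a : seq 'I_n.-1) : inv (\prod_(i <- a) gen i) <= size a.
Proof.
elim: a => [|i a IHa].
  rewrite big_nil leqn0 cards_eq0; apply/eqP/setP => -[x y].
  by rewrite !inE /= !perm1; case: ltngtP.
rewrite big_cons /=; set w := \prod_(j <- a) _ in IHa *.
have [asc|desc] := boolP (ascent i w); first by rewrite inv_gen.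
by rewrite ltnW // ltnS (leq_trans _ IHa) // (inv_gen_desc desc) ltnW.
Qed.

Lemma has_wordP w m :
  reflect (exists2 a : seq 'I_n.-1, size a = m & \prod_(i <- a) gen i = w)
          (has_word w m).
Proof.
apply: (iffP existsP) => [[a /eqP <-] | [a sz_a <-]].
  by exists a; rewrite ?size_tuple.
by exists (tcast sz_a (in_tuple a)); rewrite val_tcast.
Qed.

Lemma has_word_inv w : has_word w (inv w).
Proof.
move def_m: (inv w) => m; elim: m w def_m => [|m IHm] w def_m.
  apply/has_wordP; exists [::] => //; rewrite big_nil; apply/esym/ascents1 => i.
  by apply/idPn => /inv_gen_desc; rewrite def_m.
have [i desc] : exists i, ~~ ascent i w.
  apply/existsP; have [//|] := boolP [exists i, ~~ ascent i w].
  rewrite negb_exists => /forallP asc.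
  have w1 : w = 1 by apply: ascents1 => i; rewrite -[ascent _ _]negbK.
  by have := inv_word [::]; rewrite big_nil -w1 def_m.
have /IHm/has_wordP[a sz_a pr_a] : inv (gen i * w) = m.
  by apply: succn_inj; rewrite -inv_gen_desc.
by apply/has_wordP; exists (i :: a); rewrite /= ?sz_a // big_cons pr_a mulgenK.
Qed.

Fact has_word_ex w : exists m, has_word w m.
Proof. by exists (inv w); apply: has_word_inv. Qed.

Definition len w : nat := ex_minn (has_word_ex w).

Lemma len_inversions w : len w = #|inversions w|.
Proof.
rewrite /len; case: ex_minnP => m /has_wordP[a <- <-] min_a.
by apply/eqP; rewrite eqn_leq inv_word min_a // has_word_inv.
Qed.

Lemma len_word (a : seq 'I_n.-1) : len (\prod_(i <- a) gen i) <= size a.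
Proof. by rewrite len_inversions inv_word. Qed.

Lemma len1 : len 1 = 0.
Proof. by have := len_word [::]; rewrite big_nil leqn0 => /eqP. Qed.

Lemma lenV w : len w^-1 = len w.
Proof.
suff le_lenV x : len x^-1 <= len x.
  by apply/eqP; rewrite eqn_leq le_lenV -{1}(invgK w) le_lenV.
rewrite {2}/len; case: ex_minnP => m /has_wordP[a <- <-] _.
rewrite -size_rev; suff ->: (\prod_(i <- a) gen i)^-1 = \prod_(i <- rev a) gen i.
  exact: len_word.
elim: a => [|i a IHa]; first by rewrite !big_nil invg1.
by rewrite rev_cons big_rcons big_cons invMg IHa genV.
Qed.

Lemma len_asc i w : ascent i w -> len (gen i * w) = (len w).+1.
Proof. by rewrite !len_inversions; apply: inv_gen. Qed.

Lemma len_desc i w : ~~ ascent i w -> len w = (len (gen i * w)).+1.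
Proof. by rewrite !len_inversions; apply: inv_gen_desc. Qed.

Lemma ascentE i w : ascent i w = (len w < len (gen i * w)).
Proof.
have [/len_asc-> | /len_desc->] := boolP (ascent i w); first by rewrite ltnSn.
by rewrite ltnNge leqnSn.
Qed.

Definition rascent w i := ascent i w^-1.

Lemma rascentE i w : rascent w i = (len w < len (w * gen i)).
Proof. by rewrite /rascent ascentE -lenV -(lenV (_ * _)) invMg invgK genV. Qed.

Lemma rascent_gen i w : rascent (w * gen i) i = ~~ rascent w i.
Proof. by rewrite /rascent invMg genV ascent_gen. Qed.

Lemma ascent_exchange i j w :
  ascent i (w * gen j) != ascent i w -> gen i * w = w * gen j.
Proof.
wlog asc : w / ascent i w => [hw|].
  case asc: (ascent i w); first by move=> ne; apply: (hw) => //; rewrite asc.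
  case asc': (ascent i (w * gen j)) => // _.
  have := hw _ asc'; rewrite mulKgen asc' asc => /(_ isT).
  by rewrite mulgA => e; rewrite -(mulKgen j (gen i * w)) e.
rewrite asc eqb_id /ascent !permM -/(lo i) -/(hi i) => desc.
have e : (w (lo i), w (hi i)) = (lo j, hi j).
  by apply/eqP/idPn => ne; case/negP: desc; apply: gen_mono.
case: e => e1 e2; apply/permP => x; rewrite !permM.
rewrite (genE i) (genE j); case: tpermP => [->|->|nx1 nx2].
- by rewrite -/(lo i) e1 tpermL.
- by rewrite -/(hi i) e2 tpermR.
rewrite -/(lo j) -/(hi j) -e1 -e2 tpermD // (inj_eq perm_inj) eq_sym.
  exact/eqP.
exact/eqP.
Qed.

Lemma rascent_exchange i j w :
  rascent (gen i * w) j != rascent w j -> gen i * w = w * gen j.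
Proof.
rewrite /rascent invMg genV => /ascent_exchange /(congr1 invg).
by rewrite !invMg !genV invgK.
Qed.

Fact has_redword w :
  exists a : (len w).-tuple 'I_n.-1, \prod_(i <- a) gen i == w.
Proof. by apply/existsP; rewrite /len; case: ex_minnP. Qed.

Definition redword w : seq 'I_n.-1 := xchoose (has_redword w).

Lemma size_redword w : size (redword w) = len w.
Proof. by rewrite size_tuple. Qed.

Lemma prod_redword w : \prod_(i <- redword w) gen i = w.
Proof. exact/eqP/(xchooseP (has_redword w)). Qed.

(* Bruhat order: generated by x < x t for t a transposition with
   l(x) < l(x t). *)
Definition bruhat : rel 'S_n :=
  connect [rel x y | [exists i : 'I_n, exists j : 'I_n, y == x * tperm i j]
                     && (len x < len y)].

End SymmetricGroup.

Local Open Scope ring_scope.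

(* The Hecke algebra of S_n with parameter q: sum_w (f w) T_w is represented
   by f. *)
Definition hecke (K : fieldType) (q : K) (n : nat) : Type := {ffun 'S_n -> K^o}.
HB.instance Definition _ K q n := Vector.on (@hecke K q n).

Section Hecke.

Variables (K : fieldType) (q : K) (n : nat).
Local Notation hecke := (hecke q n).
Implicit Types (f g h : hecke) (w x y : 'S_n) (i j : 'I_n.-1).

Definition T w : hecke := [ffun x => (x == w)%:R].

(* Left and right multiplication by T_s, s = gen i, where
   T_s T_x = T_{sx} if l(sx) > l(x) and (q - 1) T_x + q T_{sx} otherwise. *)
Definition lmul i f : hecke :=
  [ffun x => if (len x < len (gen i * x)%g)%N then q * f (gen i * x)%g
             else f (gen i * x)%g + (q - 1) * f x].

Definition rmul i f : hecke :=
  [ffun x => if (len x < len (x * gen i)%g)%N then q * f (x * gen i)%g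
             else f (x * gen i)%g + (q - 1) * f x].

Lemma lmulE i f x : lmul i f x =
  if ascent i x then q * f (gen i * x)%g else f (gen i * x)%g + (q - 1) * f x.
Proof. by rewrite ffunE -(ascentE i x). Qed.

Lemma rmulE i f x : rmul i f x =
  if rascent x i then q * f (x * gen i)%g else f (x * gen i)%g + (q - 1) * f x.
Proof. by rewrite ffunE -(rascentE i x). Qed.

Lemma lmul_rmul i j f : lmul i (rmul j f) = rmul j (lmul i f).
Proof.
apply/ffunP => y.
rewrite (lmulE i (rmul j f) y) (rmulE j f y) (rmulE j f (gen i * y)%g).
rewrite (rmulE j (lmul i f) y) (lmulE i f y) (lmulE i f (y * gen j)%g).
rewrite -(mulgA (gen i) y (gen j)).
have [e | ne] := eqVneq (gen i * y)%g (y * gen j)%g.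
  have ea : ascent i y = rascent y j by rewrite ascentE rascentE e.
  rewrite [in rascent _ j]e -[in ascent i (_ * _)%g]e.
  rewrite rascent_gen ascent_gen ea e -ea.
  by case: ifP => _ /=; ring.
have -> : ascent i (y * gen j) = ascent i y.
  by apply: contraNeq ne => /ascent_exchange/eqP.
have -> : rascent (gen i * y) j = rascent y j.
  by apply: contraNeq ne => /rascent_exchange/eqP.
by do 2!case: ifP => _; ring.
Qed.

Lemma lmulP i a f g : lmul i (a *: f + g) = a *: lmul i f + lmul i g.
Proof.
by apply/ffunP => x; rewrite !ffunE; case: ifP => _; rewrite /GRing.scale /=; ring.
Qed.

Lemma rmulP i a f g : rmul i (a *: f + g) = a *: rmul i f + rmul i g.
Proof.
by apply/ffunP => x; rewrite !ffunE; case: ifP => _; rewrite /GRing.scale /=; ring.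
Qed.

Lemma lmul_T i w : (len w < len (gen i * w)%g)%N -> lmul i (T w) = T (gen i * w)%g.
Proof.
move=> asc; apply/ffunP => x; rewrite !ffunE.
rewrite (can2_eq (mulgenK i) (mulgenK i)).
have [-> | ne] := eqVneq x (gen i * w)%g.
  rewrite mulgenK ltnNge (ltnW asc) /= (eq_sym (gen i * w)%g).
  have -> : (w == gen i * w)%g = false.
    by apply/eqP => e; rewrite -e ltnn in asc.
  by rewrite mulr0 addr0.
case: ifP => [_|]; first by rewrite mulr0.
have [-> | _] := eqVneq x w; first by rewrite asc.
by rewrite mulr0 addr0.
Qed.

Lemma rmul_T i w : (len w < len (w * gen i)%g)%N -> rmul i (T w) = T (w * gen i)%g.
Proof.
move=> asc; apply/ffunP => x; rewrite !ffunE.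
rewrite -(inj_eq (mulIg (gen i)) (x * _)%g w) mulKgen.
have [-> | ne] := eqVneq x (w * gen i)%g.
  rewrite mulKgen ltnNge (ltnW asc) /= (eq_sym (w * gen i)%g).
  have -> : (w == w * gen i)%g = false.
    by apply/eqP => e; rewrite -e ltnn in asc.
  by rewrite mulr0 addr0.
case: ifP => [_|]; first by rewrite mulr0.
have [-> | _] := eqVneq x w; first by rewrite asc.
by rewrite mulr0 addr0.
Qed.

Lemma lmul_quad i f : lmul i (lmul i f) = (q - 1) *: lmul i f + q *: f.
Proof.
apply/ffunP => x; rewrite (lmulE i (lmul i f) x) [RHS]ffunE [X in _ = X + _]ffunE.
rewrite [X in _ = _ + X]ffunE (lmulE i f x) (lmulE i f (gen i * x)%g).
rewrite ascent_gen mulgenK.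
by case: ascent => /=; rewrite /GRing.scale /=; ring.
Qed.

Lemma hecke_basis f : f = \sum_w f w *: T w.
Proof.
apply/ffunP => x; rewrite sum_ffunE.
have e w : (f w *: T w) x = f w * (x == w)%:R by rewrite ffunE [T w x]ffunE.
rewrite (bigD1 x) //= e eqxx mulr1 big1 ?addr0 // => w ne.
by rewrite e eq_sym (negbTE ne) mulr0.
Qed.

(* T_x acts as T_{s_1} ... T_{s_r} for a reduced word s_1 ... s_r of x. *)
Definition lmulT x g : hecke := foldr lmul g (redword x).
Definition hecke_mul f g : hecke := \sum_x f x *: lmulT x g.

Lemma foldr_lmulP a b f g :
  foldr lmul (b *: f + g) a = b *: foldr lmul f a + foldr lmul g a.
Proof. by elim: a => //= i a ->; rewrite lmulP. Qed.

Lemma rmul_sum i (I : finType) (c : I -> K) (F : I -> hecke) :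
  rmul i (\sum_k c k *: F k) = \sum_k c k *: rmul i (F k).
Proof.
apply: (big_rec2 (fun f g => rmul i f = g)) => [|k f g _ <-].
  by have := rmulP i (-1) 0 0; rewrite scaler0 addr0 scaleN1r addNr.
exact: rmulP.
Qed.

Lemma foldr_lmul_rmul a i g : foldr lmul (rmul i g) a = rmul i (foldr lmul g a).
Proof. by elim: a => //= j a ->; rewrite lmul_rmul. Qed.

Lemma hecke_mul_rmul f i g : hecke_mul f (rmul i g) = rmul i (hecke_mul f g).
Proof.
by rewrite rmul_sum; apply: eq_bigr => x _; rewrite /lmulT foldr_lmul_rmul.
Qed.

Lemma foldr_lmul_T (a : seq 'I_n.-1) :
  len (\prod_(i <- a) gen i)%g = size a ->
  foldr lmul (T 1%g) a = T (\prod_(i <- a) gen i)%g.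
Proof.
elim: a => [|i a IHa]; first by rewrite big_nil.
rewrite big_cons /=; set w := (\prod_(j <- a) gen j)%g in IHa *.
have len_w : (len w <= size a)%N by apply: len_word.
have [asc | desc] := boolP (ascent i w); last first.
  have := len_desc desc => e1 e2; move: len_w; rewrite e1 e2 => /ltnW.
  by rewrite ltnn.
rewrite (len_asc asc) => -[e]; rewrite IHa // lmul_T //.
by rewrite (len_asc asc).
Qed.

Lemma lmulT_T1 x : lmulT x (T 1%g) = T x.
Proof.
by rewrite /lmulT foldr_lmul_T prod_redword ?size_redword.
Qed.

Lemma hecke_mul1 f : hecke_mul f (T 1%g) = f.
Proof.
by rewrite [RHS]hecke_basis; apply: eq_bigr => x _; rewrite lmulT_T1.
Qed.

Definition rmul_closed (L : hecke -> hecke) : Prop :=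
  (forall a f g, L (a *: f + g) = a *: L f + L g) /\
  (forall i f, L (rmul i f) = rmul i (L f)).

Lemma rmul_closed_eq L1 L2 : rmul_closed L1 -> rmul_closed L2 ->
  L1 (T 1%g) = L2 (T 1%g) -> L1 =1 L2.
Proof.
move=> [lin1 com1] [lin2 com2] eq1.
have eqT w : L1 (T w) = L2 (T w).
  move def_m: (len w) => m; elim: m w def_m => [|m IHm] w def_m.
    suff -> : w = 1%g by [].
    rewrite -(prod_redword w); have := size_redword w; rewrite def_m => /size0nil ->.
    by rewrite big_nil.
  have [j desc] : exists j, ~~ ascent j w^-1%g.
    apply/existsP; have [//|] := boolP [exists j, ~~ ascent j w^-1%g].
    rewrite negb_exists => /forallP asc.
    have w1 : w^-1%g = 1%g by apply: ascents1 => j; rewrite -[ascent _ _]negbK.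
    by move: def_m; rewrite -lenV w1 len1.
  have asc : rascent (w * gen j) j by rewrite rascent_gen.
  rewrite -(mulKgen j w) -rmul_T -?rascentE // com1 com2 IHm //.
  apply: succn_inj; rewrite -def_m -(lenV w) (len_desc desc).
  by rewrite -(lenV (w * _)) invMg genV.
move=> f; rewrite (hecke_basis f).
have sumE (L : hecke -> hecke) : (forall a g h, L (a *: g + h) = a *: L g + L h) ->
    L (\sum_w f w *: T w) = \sum_w f w *: L (T w).
  move=> lin; apply: (big_rec2 (fun f g => L f = g)) => [|w g1 g2 _ <-] //.
  by have := lin (-1) 0 0; rewrite scaler0 addr0 scaleN1r addNr.
by rewrite !sumE //; apply: eq_bigr => w _; rewrite eqT.
Qed.

Lemma hecke_mulP f a g h :
  hecke_mul f (a *: g + h) = a *: hecke_mul f g + hecke_mul f h.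
Proof.
rewrite /hecke_mul scaler_sumr -big_split; apply: eq_bigr => x _ /=.
by rewrite /lmulT foldr_lmulP scalerDr !scalerA mulrC.
Qed.

Lemma hecke_mulPl f a g h :
  hecke_mul (a *: f + g) h = a *: hecke_mul f h + hecke_mul g h.
Proof.
rewrite /hecke_mul scaler_sumr -big_split; apply: eq_bigr => x _ /=.
by rewrite !ffunE scalerDl scalerA.
Qed.

Lemma rmul_closed_mul f : rmul_closed (hecke_mul f).
Proof. by split=> *; rewrite ?hecke_mulP ?hecke_mul_rmul. Qed.

Fact hecke_mulA : associative hecke_mul.
Proof.
move=> f g; apply: rmul_closed_eq; last by rewrite !hecke_mul1.
  by split=> *; rewrite ?hecke_mulP ?hecke_mul_rmul.
exact: rmul_closed_mul.
Qed.

Fact hecke_mul1r : right_id (T 1%g) hecke_mul.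
Proof. exact: hecke_mul1. Qed.

Fact hecke_mul1l : left_id (T 1%g) hecke_mul.
Proof.
apply: rmul_closed_eq; [exact: rmul_closed_mul | by [] | exact: hecke_mul1].
Qed.

Fact hecke_mulDl : left_distributive hecke_mul +%R.
Proof. by move=> f g h; have := hecke_mulPl f 1 g h; rewrite !scale1r. Qed.

Fact hecke_mulDr : right_distributive hecke_mul +%R.
Proof. by move=> f g h; have := hecke_mulP f 1 g h; rewrite !scale1r. Qed.

Fact hecke_1_neq0 : T 1%g != 0.
Proof.
by apply/eqP => /ffunP/(_ 1%g)/eqP; rewrite !ffunE eqxx oner_eq0.
Qed.

HB.instance Definition _ := GRing.Zmodule_isNzRing.Build hecke
  hecke_mulA hecke_mul1l hecke_mul1r hecke_mulDl hecke_mulDr hecke_1_neq0.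

Fact hecke_scaleAl a f g : a *: (f * g) = (a *: f) * g.
Proof.
have z0 : hecke_mul 0 g = 0 := mul0r (g : hecke).
by have := hecke_mulPl f a 0 g; rewrite z0 !addr0.
Qed.

Fact hecke_scaleAr a f g : a *: (f * g) = f * (a *: g).
Proof.
have z0 : hecke_mul f 0 = 0 := mulr0 (f : hecke).
by have := hecke_mulP f a g 0; rewrite z0 !addr0.
Qed.

HB.instance Definition _ :=
  GRing.Lmodule_isLalgebra.Build K hecke hecke_scaleAl.
HB.instance Definition _ :=
  GRing.Lalgebra_isAlgebra.Build K hecke hecke_scaleAr.
HB.instance Definition _ := Algebra_isFalgebra.Build K hecke.

Lemma T1 : T 1%g = 1. Proof. by []. Qed.

Lemma len_gen i : len (gen i) = 1%N.
Proof.
rewrite -(mulg1 (gen i)) len_asc ?len1 //.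
by rewrite /ascent !perm1 /=.
Qed.

Lemma mul_Tgen i f : T (gen i) * f = lmul i f.
Proof.
move: f; apply: (@rmul_closed_eq (hecke_mul (T (gen i)))).
- exact: rmul_closed_mul.
- by split=> *; rewrite ?lmulP ?lmul_rmul.
by rewrite hecke_mul1 lmul_T mulg1 // len1 len_gen.
Qed.

Lemma T_mul i w :
  (len w < len (gen i * w)%g)%N -> T (gen i) * T w = T (gen i * w)%g.
Proof. by rewrite mul_Tgen; apply: lmul_T. Qed.

Lemma T_quad i : T (gen i) * T (gen i) = (q - 1) *: T (gen i) + q *: T 1%g.
Proof.
have e : T (gen i) = lmul i (T 1%g) by rewrite -mul_Tgen T1 mulr1.
by rewrite mul_Tgen {1}e lmul_quad -e.
Qed.

Lemma T_gen_unit i : q != 0 -> T (gen i) \is a GRing.unit.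
Proof.
move=> q_neq0; apply/unitrP; exists (q^-1 *: (T (gen i) - (q - 1)%:A)).
rewrite -scalerAl -scalerAr mulrBl mulrBr -scalerAl -scalerAr mul1r mulr1.
by rewrite T_quad addrC addKr scalerA mulVf //  scale1r.
Qed.

Lemma T_unit w : q != 0 -> T w \is a GRing.unit.
Proof.
move=> q_neq0.
have -> : T w = \prod_(i <- redword w) T (gen i).
  rewrite -(lmulT_T1 w) /lmulT; elim: (redword w) => [|i a IHa].
    by rewrite big_nil T1.
  by rewrite big_cons /= IHa mul_Tgen.
by apply: rpred_prod => i _; apply: T_gen_unit.
Qed.

End Hecke.

(* The field Q(q^{1/2}), realized as Q(v) with v = q^{1/2}. *)
Notation Qv := {fraction {poly rat}}.
Notation "x %:F" := (@FracField.tofrac {poly rat} x) : ring_scope.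

Definition v : Qv := 'X%:F.
Definition q : Qv := v ^+ 2.

Lemma v_neq0 : v != 0. Proof. by rewrite tofrac_eq0 polyX_eq0. Qed.
Lemma q_neq0 : q != 0. Proof. by rewrite expf_neq0 ?v_neq0. Qed.

(* p |-> p(v^-1) *)
Definition eval_vinv (p : {poly rat}) : Qv :=
  (map_poly (fun c : rat => c%:P%:F) p).[v^-1].

Definition bar (z : Qv) : Qv :=
  eval_vinv \n_(generic_quotient.repr z) / eval_vinv \d_(generic_quotient.repr z).

Lemma eval_vinv_polyC c : eval_vinv c%:P = c%:P%:F.
Proof. by rewrite /eval_vinv (map_polyC (@FracField.tofrac _ \o polyC)) hornerC. Qed.

Lemma eval_vinvX : eval_vinv 'X = v^-1.
Proof. by rewrite /eval_vinv (map_polyX (@FracField.tofrac _ \o polyC)) hornerX. Qed.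

Fact eval_vinv_is_zmod_morphism : zmod_morphism eval_vinv.
Proof.
by move=> p r; rewrite /eval_vinv (raddfB (map_poly (@FracField.tofrac _ \o polyC)))
  !hornerE.
Qed.

Fact eval_vinv_is_monoid_morphism : monoid_morphism eval_vinv.
Proof.
split=> [|p r]; first by rewrite -polyC1 eval_vinv_polyC tofrac1.
by rewrite /eval_vinv (rmorphM (map_poly (@FracField.tofrac _ \o polyC))) hornerM.
Qed.

HB.instance Definition _ :=
  GRing.isZmodMorphism.Build {poly rat} Qv eval_vinv eval_vinv_is_zmod_morphism.
HB.instance Definition _ :=
  GRing.isMonoidMorphism.Build {poly rat} Qv eval_vinv
    eval_vinv_is_monoid_morphism.

Lemma eval_vinvE (p : {poly rat}) :
  v ^+ (size p).-1 * eval_vinv p = (\sum_(i < size p) p`_i *: 'X^((size p).-1 - i))%:F.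
Proof.
rewrite -[in X in _ * X](coefK p) poly_def !rmorph_sum /= mulr_sumr.
apply: eq_bigr => i _; rewrite -!mul_polyC !rmorphM /= !rmorphXn /=.
rewrite eval_vinv_polyC eval_vinvX mulrCA exprVn -/v; congr (_ * _).
rewrite expfB_cond // (negbTE v_neq0) add0n -ltnS prednK ?ltn_ord //.
exact: leq_ltn_trans (leq0n _) (ltn_ord i).
Qed.

Lemma eval_vinv_eq0 p : (eval_vinv p == 0) = (p == 0).
Proof.
apply/idP/idP => [/eqP p0 | /eqP->]; last by rewrite rmorph0.
have := eval_vinvE p; rewrite p0 mulr0 => /esym/eqP; rewrite tofrac_eq0.
move/eqP/(congr1 (coefp 0)); rewrite /= coef0 coef_sum.
have [// | p_neq0] := eqVneq p 0; have sz := p_neq0; rewrite -size_poly_gt0 in sz.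
have lt_k : ((size p).-1 < size p)%N by rewrite prednK.
rewrite (bigD1 (Ordinal lt_k)) //= big1 => [|i ne_i].
  rewrite subnn coefZ coefXn eqxx mulr1 addr0 => /eqP.
  by rewrite -/(lead_coef p) lead_coef_eq0 (negbTE p_neq0).
rewrite coefZ coefXn eq_sym subn_eq0 leqNgt.
suff ->: (i < (size p).-1)%N by rewrite mulr0.
by rewrite ltn_neqAle -ltnS prednK // ltn_ord andbT.
Qed.

Lemma frac_numden (z : Qv) :
  z = (\n_(generic_quotient.repr z))%:F / (\d_(generic_quotient.repr z))%:F.
Proof.
rewrite -[LHS]generic_quotient.reprK; case: (generic_quotient.repr z) => -[a b] /= b_neq0.
apply: (canRL (mulfK _)); first by rewrite tofrac_eq0.
unlock FracField.tofrac; rewrite -[LHS]FracField.pi_mul.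
apply/generic_quotient.eqmodP; rewrite /= FracField.equivfE /FracField.mulf /=.
by rewrite !numden_Ratio ?mulf_neq0 ?oner_neq0 // !mulr1 mulrC.
Qed.

Lemma fracP (z : Qv) : exists p, exists2 r, r != 0 & z = p%:F / r%:F.
Proof.
exists (\n_(generic_quotient.repr z)), (\d_(generic_quotient.repr z)).
  exact: denom_ratioP.
exact: frac_numden.
Qed.

Lemma bar_frac p r : r != 0 -> bar (p%:F / r%:F) = eval_vinv p / eval_vinv r.
Proof.
move=> r_neq0; set z := _ / _; rewrite /bar; have := frac_numden z.
have := denom_ratioP (generic_quotient.repr z); move: (\n_ _) (\d_ _) => a b b_neq0.
move/eqP; rewrite /z eqr_div ?tofrac_eq0 // -!rmorphM tofrac_eq => /eqP e.
by apply/eqP; rewrite eqr_div ?eval_vinv_eq0 // -!rmorphM /= e.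
Qed.

Fact bar_is_zmod_morphism : zmod_morphism bar.
Proof.
move=> y z; have [a [b b_neq0 ->]] := fracP y; have [c [d d_neq0 ->]] := fracP z.
rewrite !bar_frac // -!mulNr -!rmorphN !addf_div ?tofrac_eq0 ?eval_vinv_eq0 //.
by rewrite -!rmorphM -!rmorphD bar_frac ?mulf_neq0.
Qed.

Fact bar_is_monoid_morphism : monoid_morphism bar.
Proof.
split=> [|y z].
  have := bar_frac 1 (oner_neq0 {poly rat}).
  by rewrite (rmorph1 eval_vinv) tofrac1 !divr1.
have [a [b b_neq0 ->]] := fracP y; have [c [d d_neq0 ->]] := fracP z.
by rewrite mulf_div -!tofracM !bar_frac ?mulf_neq0 // mulf_div -!rmorphM.
Qed.

HB.instance Definition _ :=
  GRing.isZmodMorphism.Build Qv Qv bar bar_is_zmod_morphism.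
HB.instance Definition _ :=
  GRing.isMonoidMorphism.Build Qv Qv bar bar_is_monoid_morphism.

Lemma bar_v : bar v = v^-1.
Proof.
have := bar_frac 'X (oner_neq0 {poly rat}).
by rewrite (rmorph1 eval_vinv) eval_vinvX tofrac1 !divr1.
Qed.

Section KazhdanLusztig.

Variable n : nat.
Local Notation hecke := (hecke q n).
Local Notation T := (@T _ q n).
Implicit Types (h : hecke) (w x : 'S_n).

(* The semilinear involution sending T_w to the inverse of T_{w^-1}. *)
Definition hecke_bar h : hecke := \sum_w bar (h w) *: (T w^-1%g)^-1.

(* p |-> p(q) *)
Definition at_q (p : {poly rat}) : Qv := (p \Po 'X^2)%:F.

Definition Cprime w (P : 'S_n -> {poly rat}) : hecke :=
  v ^- len w *: \sum_(x | bruhat x w) at_q (P x) *: T x.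

(* P is the family x |-> P_{x,w}. *)
Definition is_KL w (P : 'S_n -> {poly rat}) : Prop :=
  [/\ hecke_bar (Cprime w P) = Cprime w P,
      forall x, bruhat x w -> x != w ->
        ((size (P x)).-1.*2 <= len w - len x - 1)%N,
      P w = 1
    & forall x, ~~ bruhat x w -> P x = 0].

(* P_{x,w}; by the theorem of Kazhdan and Lusztig exactly one family satisfies
   is_KL w, so the choice and its default value are immaterial. *)
Definition KLpoly x w : {poly rat} :=
  epsilon (inhabits (fun=> 0)) (is_KL w) x.

End KazhdanLusztig.

Fixpoint fib_q (m : nat) : {poly rat} :=
  if m is m'.+1 then
    if m' is m''.+1 then fib_q m' + 'X * fib_q m'' else 1
  else 1.

(* A word is a sequence of indices i, standing for the letters s_i. *)
Definition word_val (n : nat) (a : seq nat) : 'S_n := (\prod_(i <- a) adj n i)%g.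

Definition reduced (n : nat) (a : seq nat) : Prop :=
  all (fun i => 1 <= i < n)%N a /\ len (word_val n a) = size a.

Definition word_kl (k l : nat) : seq nat :=
  flatten [seq [:: j; j.-1] | j <- iota k (l - k).+1].

(* Main.v *)
Require Import Defs.
From mathcomp Require Import all_boot all_order all_fingroup all_algebra.
From mathcomp Require Import falgebra zify.
From Stdlib Require Import ClassicalEpsilon.

(** Write [C_i = 1 + T_(s_i)], up to a power of [v] the Kazhdan-Lusztig element
    of a simple reflection.  The reason behind the theorem is that the product
    [C_k C_(k-1) C_(k+1) C_k ... C_l C_(l-1)], normalised by [v ^- len w], is
    already the Kazhdan-Lusztig element of [w = w_(k,l)].  It is invariant
    under the bar involution, because each [v^-1 C_i] is
    ([hecke_bar_mul1T_gen]), so what has to be controlled is the support and the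
    degrees of its coefficients.

    Add one block at a time.  Let [P] be the family of coefficients of the
    product for [w], which lives in the parabolic subgroup [W] generated by
    the letters below [t = s_l], and let [s = s_(l-1)].  The product with
    [(1 + T_t) (1 + T_s)] lives in [W], [W t] and [W t s], and its
    coefficients are
      - [P u] at [u t] and at [u t s], for [u] in [W];
      - [P u + q P (u s)] at [u] and at [u s], for [u] in [W] with [u < u s].
    Since [len (w t s) = len w + 2], the degree bound for [P] yields the one
    for the new family with the single possible exception of the term
    [q P (u s)] when [u s = w]; that case does not occur because [w < w s]
    ([block_deg]).  The latter inequality is inherited from block to block by
    a braid relation ([ascent_tst]).  The support stays below [w t s] in the
    Bruhat order by the lifting property [bruhat_mul_gen], which rests on the
    description of the length of [x * tperm a b] ([len_mul_tperm]).

    Consider the coefficients at [1] and at the largest letter of the word, which is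
    [s] for [w] and [t] for [w t s]: a block replaces [(P 1, P s)] by
    [(P 1 + q P s, P 1)], which is the Fibonacci recursion ([blocks_KL]).

    As [KLpoly] is an arbitrary family with the defining properties, it also
    has to be shown that there is only one ([is_KL_unique]).  This follows from
    unitriangularity of the bar involution with respect to the length
    ([hecke_bar_T_top]): at an element of maximal length in the support of the
    difference of two families, invariance equates a polynomial of small degree
    in [q] with one whose terms all have large degree. *)

(** * Length and Bruhat order under transpositions *)

Section Length.
Set Implicit Arguments.
Unset Strict Implicit.
Import GroupScope GRing.Theory.
Local Open Scope group_scope.

Variable n : nat.
Implicit Types (u w x y : 'S_n) (i j : 'I_n.-1).

Lemma len_gen_le i u : len u <= (len (gen i * u)).+1.
Proof.
have [/len_asc->|/len_desc->//] := boolP (ascent i u).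
by rewrite !leqW.
Qed.

Lemma gen_adjacent (a b : 'I_n) :
  a.+1 = b -> exists2 i, gen i = tperm a b & forall u, ascent i u = (u a < u b).
Proof.
move=> ab; have lt_a : a < n.-1 by case: n a b ab => [|m] [a ha] [b hb] //= e; lia.
exists (Ordinal lt_a).
  by rewrite genE; congr tperm; apply: val_inj.
by move=> u; rewrite /ascent; congr (_ (u _) < _ (u _)); apply: val_inj.
Qed.

(** By induction on [b - a]: for [c] next to [a], [tperm a b] is the conjugate of
    [tperm c b] by the simple reflection [tperm a c], and each of the two outer
    reflections changes the length by one in a known direction. *)
Lemma len_tperm_lt u (a b : 'I_n) : a < b -> u a < u b ->
  len u < len (tperm a b * u).
Proof.
move def_d: (b - a) => d; elim: d a b u def_d => [|d IHd] a b u; first by lia.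
move=> def_d lt_ab lt_u.
have lt_a1 : a.+1 < n by apply: leq_ltn_trans (ltn_ord b).
pose c := Ordinal lt_a1.
have [i gi asci] := @gen_adjacent a c erefl.
have [eq_cb | ne_cb] := eqVneq c b.
  by rewrite -eq_cb -gi len_asc // asci eq_cb.
have ne_ac : a != c by rewrite -val_eqE /= neq_ltn ltnSn.
have ne_ab : a != b by rewrite -val_eqE /= neq_ltn lt_ab.
have lt_cb : c < b by rewrite ltn_neqAle val_eqE ne_cb.
have def_t : tperm a b * u = gen i * (tperm c b * (gen i * u)).
  rewrite gi !mulgA; congr (_ * u).
  have := tpermJ a b (tperm a c); rewrite tpermL tpermD //.
  by move=> <-; rewrite conjgE tpermV !mulgA tperm2 mul1g -mulgA tperm2 mulg1.
have lt1 : len (gen i * u) < len (tperm c b * (gen i * u)).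
  apply: IHd => //; first by rewrite /=; lia.
  by rewrite !permM gi tpermR tpermD.
rewrite def_t; have [asc | desc] := boolP (ascent i u).
  by have := len_gen_le i (tperm c b * (gen i * u)); move: lt1; rewrite len_asc //; lia.
rewrite len_asc; first by rewrite (len_desc desc) ltnS.
rewrite asci !permM gi (@tpermD _ c b a) 1?eq_sym // !tpermL tpermD //.
rewrite (leq_ltn_trans _ lt_u) //.
by move: desc; rewrite asci -leqNgt.
Qed.

Lemma len_tperm u (a b : 'I_n) : a < b ->
  (len u < len (tperm a b * u)) = (u a < u b).
Proof.
move=> lt_ab; apply/idP/idP => [|/(len_tperm_lt lt_ab)//].
apply: contraLR; rewrite -!leqNgt leq_eqVlt val_eqE (inj_eq perm_inj).
have ne_ab : b != a by rewrite -val_eqE /= neq_ltn lt_ab orbT.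
rewrite (negbTE ne_ab) /= => lt_u.
have := @len_tperm_lt (tperm a b * u) a b lt_ab.
by rewrite !permM tpermL tpermR mulgA tperm2 mul1g => /(_ lt_u)/ltnW.
Qed.

Lemma len_mul_tperm x (a b : 'I_n) : a < b ->
  (len x < len (x * tperm a b)) = (x^-1 a < x^-1 b).
Proof. by move=> lt_ab; rewrite -len_tperm // -lenV -(lenV (_ * _)) invMg tpermV. Qed.

Lemma rlen_asc w i : rascent w i -> len (w * gen i) = (len w).+1.
Proof. by move=> asc; rewrite -[LHS]lenV invMg Defs.genV len_asc ?lenV. Qed.

Lemma bruhat_refl x : bruhat x x. Proof. exact: connect0. Qed.

Lemma bruhat_gen w i : rascent w i -> bruhat w (w * gen i).
Proof.
move=> asc; apply: connect1 => /=; rewrite rlen_asc // ltnSn andbT genE.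
by apply/existsP; eexists; apply/existsP; eexists; apply: eqxx.
Qed.

Lemma bruhat_step x (a b : 'I_n) :
  len x < len (x * tperm a b) -> bruhat x (x * tperm a b).
Proof.
move=> lt; apply: connect1; rewrite /= lt andbT.
by apply/existsP; exists a; apply/existsP; exists b.
Qed.

Lemma bruhat_len x w : bruhat x w -> x != w -> len x < len w.
Proof.
case/connectP=> p; elim: p x => [|y p IHp] x /=; first by move=> _ ->; rewrite eqxx.
case/andP=> /andP[_ lt_xy] path_p def_w _.
have [<- // | ne] := eqVneq y w.
exact: ltn_trans lt_xy (IHp y path_p def_w ne).
Qed.

(** The reflection [tperm a b], conjugated by [gen i], still increases the length
    of [x * gen i] because [gen i] preserves the order of [a] and [b], unless
    [tperm a b] is [gen i] itself. *)
Lemma bruhat_mul_step x (a b : 'I_n) i : len x < len (x * tperm a b) ->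
  x * gen i = x * tperm a b \/ bruhat (x * gen i) (x * tperm a b * gen i).
Proof.
wlog lt_ab : a b / a < b.
  move=> hw; case: (ltngtP a b) => [||/val_inj->]; first exact: hw.
    by rewrite tpermC; apply: hw.
  by rewrite tperm1 mulg1 ltnn.
move=> lt_x; have lt_inv := lt_x; rewrite len_mul_tperm // in lt_inv.
have -> : x * tperm a b * gen i = x * gen i * tperm (gen i a) (gen i b).
  by rewrite -tpermJ conjgE Defs.genV !mulgA mulKgen.
have [e | ne] := eqVneq (a, b) (Ordinal (gen_lt1 i), Ordinal (gen_lt2 i)).
  by left; rewrite genE; case: e => -> ->.
right; apply: bruhat_step; rewrite len_mul_tperm ?gen_mono //.
by rewrite invMg Defs.genV !permM -!(permM (gen i) (gen i)) genK !perm1.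
Qed.

(** The lifting property of the Bruhat order, for right multiplication. *)
Lemma bruhat_mul_gen x w i : rascent w i -> bruhat x w ->
  bruhat (x * gen i) (w * gen i).
Proof.
move=> asc; have up y : bruhat y w -> bruhat y (w * gen i).
  by move/connect_trans; apply; apply: bruhat_gen.
case/connectP=> p; elim: p x => [|y p IHp] x /=.
  by move=> _ ->; apply: bruhat_refl.
case/andP=> /andP[/existsP[a /existsP[b /eqP def_y]] lt_xy] path_p def_w.
have le_yw : bruhat y w by apply/connectP; exists p.
rewrite def_y in lt_xy.
case: (bruhat_mul_step i lt_xy) => [->|]; rewrite -def_y; first exact: up.
by move/connect_trans; apply; apply: IHp path_p def_w.
Qed.

End Length.

(** * The bar involution on the Hecke algebra *)

Section BarInvolution.
Set Implicit Arguments.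
Unset Strict Implicit.
Import GroupScope GRing.Theory.
Local Open Scope ring_scope.

Variable n : nat.
Local Notation hecke := (hecke q n).
Local Notation T := (@T _ q n).
Implicit Types (f g : hecke) (u w x y : 'S_n) (i j : 'I_n.-1).

(* The consequences of the quadratic relation, with [t] in the role of [T (gen i)]
   and [c] in that of [q]. *)
Section QuadraticInverse.

Variables (K : fieldType) (A : unitAlgType K) (c : K) (t : A).
Hypotheses (c_neq0 : c != 0) (t_unit : t \is a GRing.unit).
Hypothesis t_quad : t * t = (c - 1) *: t + c *: 1.

Lemma quad_mulr (x : A) : x * t * t = (c - 1) *: (x * t) + c *: x.
Proof. by rewrite -mulrA t_quad mulrDr -!scalerAr mulr1. Qed.

Lemma quad_mulV (x : A) : x / t = c^-1 *: (x * t - (c - 1) *: x).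
Proof.
apply: (mulIr t_unit); rewrite divrK // -scalerAl mulrBl quad_mulr.
by rewrite -scalerAl addrC addKr scalerA mulVf // scale1r.
Qed.

Lemma quad_mulVV (x : A) : x / t / t = (c^-1 - 1) *: (x / t) + c^-1 *: x.
Proof.
rewrite [LHS]quad_mulV divrK // scalerBr scalerA addrC -scaleNr.
by congr (_ *: _ + _); rewrite mulrBr mulVf // mulr1 opprB.
Qed.

Lemma quad_add_mulV (x : A) : x + x / t = c^-1 *: (x * (1 + t)).
Proof.
apply: (scalerI c_neq0); rewrite quad_mulV scalerDr !scalerA divff // !scale1r.
rewrite mulrDr mulr1 addrCA -scalerBl opprB addrCA subrr addr0 scale1r.
exact: addrC.
Qed.

End QuadraticInverse.

Lemma mulr_Tgen f i : f * T (gen i) = rmul i f.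
Proof.
have -> : T (gen i) = rmul i (T 1%g).
  by rewrite rmul_T mul1g // len1 len_gen.
by rewrite -[f * _]/(hecke_mul f _) hecke_mul_rmul hecke_mul1.
Qed.

Lemma T_genV f i : f / T (gen i) = q^-1 *: (f * T (gen i) - (q - 1) *: f).
Proof. exact: quad_mulV q_neq0 (T_gen_unit i q_neq0) (T_quad q i) f. Qed.

Lemma T_add_mulV f i : f + f / T (gen i) = q^-1 *: (f * (1 + T (gen i))).
Proof. exact: quad_add_mulV q_neq0 (T_gen_unit i q_neq0) (T_quad q i) f. Qed.

Lemma bar_q : bar q = q^-1.
Proof. by rewrite /q rmorphXn /= bar_v exprVn. Qed.

Lemma hecke_barP a f g : hecke_bar (a *: f + g) = bar a *: hecke_bar f + hecke_bar g.
Proof.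
rewrite /hecke_bar scaler_sumr -big_split /=; apply: eq_bigr => w _.
by rewrite !ffunE scalerA -scalerDl /GRing.scale /= rmorphD rmorphM.
Qed.

Lemma hecke_bar0 : hecke_bar (0 : hecke) = 0.
Proof. by rewrite /hecke_bar big1 // => w _; rewrite ffunE rmorph0 scale0r. Qed.

Lemma hecke_barZ a f : hecke_bar (a *: f) = bar a *: hecke_bar f.
Proof. by rewrite -[a *: f]addr0 hecke_barP hecke_bar0 addr0. Qed.

Lemma hecke_barB f g : hecke_bar (f - g) = hecke_bar f - hecke_bar g.
Proof. by rewrite addrC -scaleN1r hecke_barP rmorphN rmorph1 scaleN1r addrC. Qed.

Lemma hecke_bar_sum (I : finType) (c : I -> Qv) (F : I -> hecke) :
  hecke_bar (\sum_k c k *: F k) = \sum_k bar (c k) *: hecke_bar (F k).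
Proof.
apply: (big_rec2 (fun f g => hecke_bar f = g)) => [|k f g _ <-].
  exact: hecke_bar0.
exact: hecke_barP.
Qed.

Lemma hecke_bar_T w : hecke_bar (T w) = (T w^-1%g)^-1.
Proof.
rewrite /hecke_bar (bigD1 w) //= ffunE eqxx rmorph1 scale1r big1 ?addr0 //.
by move=> x /negbTE ne; rewrite ffunE ne rmorph0 scale0r.
Qed.

Lemma hecke_bar_T_asc w i : rascent w i ->
  hecke_bar (T (w * gen i)%g) = hecke_bar (T w) * (T (gen i))^-1.
Proof.
move=> asc; rewrite !hecke_bar_T invMg Defs.genV -T_mul -?ascentE //.
by rewrite invrM // T_unit // q_neq0.
Qed.

(** Multiplicativity of the bar involution when the right factor is [T (gen i)].  It
    suffices to check it on [T w].  If [w * gen i] is longer than [w], this is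
    [hecke_bar_T_asc]; if it is shorter, both sides are expanded by the
    quadratic relation, which [(T (gen i))^-1] satisfies with [q^-1] for [q]. *)
Lemma hecke_bar_mul f i : hecke_bar (f * T (gen i)) = hecke_bar f * (T (gen i))^-1.
Proof.
rewrite {1}(hecke_basis f) mulr_suml [in RHS](hecke_basis f).
under eq_bigr do rewrite -scalerAl.
rewrite !hecke_bar_sum mulr_suml; apply: eq_bigr => w _.
rewrite -scalerAl; congr (_ *: _).
have [asc | desc] := boolP (rascent w i).
  by rewrite mulr_Tgen rmul_T -?rascentE // hecke_bar_T_asc.
have [u asc def_w] : exists2 u, rascent u i & w = (u * gen i)%g.
  by exists (w * gen i)%g; rewrite ?rascent_gen ?mulKgen.
have def_T : T w = T u * T (gen i).
  by rewrite mulr_Tgen rmul_T -?rascentE // def_w.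
have bar_w : hecke_bar (T w) = hecke_bar (T u) * (T (gen i))^-1.
  by rewrite def_w; apply: hecke_bar_T_asc.
have Tw : T w * T (gen i) = (q - 1) *: T w + q *: T u.
  by rewrite def_T; apply/quad_mulr/T_quad.
have bar_q1 : bar (q - 1) = q^-1 - 1 by rewrite rmorphB rmorph1 /= bar_q.
rewrite Tw hecke_barP hecke_barZ bar_q1 bar_q bar_w.
exact/esym/(quad_mulVV q_neq0 (T_gen_unit i q_neq0) (T_quad q i)).
Qed.

(** Here [v^-1 *: (1 + T (gen i))] is the Kazhdan-Lusztig element of [gen i]; its
    invariance amounts to [1 + (T (gen i))^-1 = q^-1 *: (1 + T (gen i))]. *)
Lemma hecke_bar_mul1T_gen h i : hecke_bar h = h ->
  hecke_bar (v^-1 *: (h * (1 + T (gen i)))) = v^-1 *: (h * (1 + T (gen i))).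
Proof.
move=> bar_h.
have bar_hC : hecke_bar (h * (1 + T (gen i))) = q^-1 *: (h * (1 + T (gen i))).
  rewrite -T_add_mulV mulrDr mulr1 -[X in hecke_bar (X + _)]scale1r hecke_barP.
  by rewrite rmorph1 scale1r hecke_bar_mul bar_h.
rewrite hecke_barZ bar_hC scalerA fmorphV /= bar_v invrK; congr (_ *: _).
by rewrite /q expr2 invfM mulrA divff ?v_neq0 // mul1r.
Qed.

Lemma rdescent_ex y m : len y = m.+1 -> exists j, ~~ rascent y j.
Proof.
move=> len_y; apply/existsP; apply: contraPT (erefl (len y)).
rewrite negb_exists => /forallP asc.
suff y1 : y^-1%g = 1%g by move: len_y; rewrite -lenV y1 len1.
by apply: ascents1 => j; have := asc j; rewrite negbK.
Qed.

(** Unitriangularity of the bar involution, with respect to length only: the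
    induction along [T y = T u * T (gen j)] then uses no more than that right
    multiplication by [gen j] changes the length by one. *)
Lemma hecke_bar_T_top y x : (len y <= len x)%N ->
  hecke_bar (T y) x = (x == y)%:R * q ^- len y.
Proof.
move def_m: (len y) => m; elim: m y x def_m => [|m IHm] y x def_m.
  move=> _; have y1 : y = 1%g.
    rewrite -(prod_redword y); have := size_redword y; rewrite def_m => /size0nil ->.
    by rewrite big_nil.
  by rewrite y1 hecke_bar_T invg1 T1 invr1 expr0 invr1 mulr1 -T1 ffunE.
move=> le_mx.
have [j desc] := rdescent_ex def_m.
set u := (y * gen j)%g.
have asc : rascent u j by rewrite rascent_gen.
have def_y : y = (u * gen j)%g by rewrite mulKgen.
have len_u : len u = m by apply: succn_inj; rewrite -(rlen_asc asc) -def_y.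
have ux0 : x != u by apply: contraTneq le_mx => ->; rewrite len_u ltnn.
rewrite def_y hecke_bar_T_asc // T_genV mulr_Tgen.
rewrite [LHS]ffunE [X in _ *: X]ffunE [X in _ + X]ffunE [X in - X]ffunE.
rewrite (IHm u x len_u) ?(ltnW le_mx) // (negbTE ux0) mul0r scaler0 subr0.
rewrite rmulE (IHm u x len_u) ?(ltnW le_mx) // (negbTE ux0) mul0r mulr0 addr0.
rewrite -def_y.
have <- : (x * gen j == u)%g = (x == y) by rewrite (inj_eq (mulIg (gen j))).
case: ifP => asc_x.
  rewrite (IHm u) // ?rlen_asc //; last by rewrite leqW // ltnW.
  have -> : (x * gen j == u)%g = false.
    apply/eqP => e; have := rlen_asc asc_x; rewrite e len_u => e'.
    by move: le_mx; rewrite e' => ?; lia.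
  by rewrite !mul0r !mulr0 scaler0.
have lenx : len x = (len (x * gen j)%g).+1.
  by rewrite -[x in LHS](mulKgen j) rlen_asc // rascent_gen asc_x.
rewrite (IHm u) // ?len_u; last by rewrite -ltnS -lenx.
by rewrite /GRing.scale /= exprS (invfM q) mulrCA.
Qed.

End BarInvolution.

(** * Uniqueness of Kazhdan-Lusztig polynomials *)

Section Uniqueness.
Set Implicit Arguments.
Unset Strict Implicit.
Import GroupScope GRing.Theory.
Local Open Scope ring_scope.

Lemma at_qB (a b : {poly rat}) : at_q (a - b) = at_q a - at_q b.
Proof. by rewrite /at_q rmorphB rmorphB. Qed.

Lemma at_qD (a b : {poly rat}) : at_q (a + b) = at_q a + at_q b.
Proof. by rewrite /at_q rmorphD rmorphD. Qed.

Lemma at_q0 : at_q 0 = 0. Proof. by rewrite /at_q rmorph0 rmorph0. Qed.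

Lemma at_qXM (a : {poly rat}) : at_q ('X * a) = q * at_q a.
Proof. by rewrite /at_q rmorphM /= comp_polyX rmorphM rmorphXn. Qed.

(** If [d(q)] has degree [e < m] in [v], then [v^(2m)] times its conjugate is
    [v^(2m - e)] times a polynomial in [v], and [2m - e > e]. *)
Lemma bar_at_q_eq0 (d : {poly rat}) m : ((size d).-1.*2 < m)%N ->
  at_q d = v ^+ m.*2 * bar (at_q d) -> d = 0.
Proof.
rewrite /at_q; set p := d \Po 'X^2 => lt_m.
have sz : (size p).-1 = (size d).-1.*2.
  by rewrite size_comp_poly size_polyXn muln2.
have -> : bar p%:F = eval_vinv p.
  have := bar_frac p (oner_neq0 {poly rat}).
  by rewrite (rmorph1 eval_vinv) tofrac1 !divr1.
have -> : m.*2 = (m.*2 - (size p).-1 + (size p).-1)%N by lia.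
rewrite exprD -mulrA eval_vinvE -rmorphXn -rmorphM => /eqP.
rewrite tofrac_eq; set r := (X in _ * X) => /eqP def_p.
apply/eqP; have <- : (p == 0) = (d == 0) by rewrite comp_poly_eq0 ?size_polyXn.
apply/negPn/negP => p_neq0; have r_neq0 : r != 0.
  by apply: contraNneq p_neq0 => r0; rewrite def_p r0 mulr0.
have := congr1 (fun a : {poly rat} => size a) def_p.
rewrite mulrC size_mulXn //; rewrite -size_poly_gt0 in r_neq0; move: sz lt_m; lia.
Qed.

Variable n : nat.
Local Notation hecke := (hecke q n).
Local Notation T := (@T _ q n).
Implicit Types (w x : 'S_n) (P : 'S_n -> {poly rat}).

Lemma heckeBE (f g : hecke) x : (f - g) x = f x - g x.
Proof. by rewrite ffunE [X in _ + X]ffunE. Qed.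

Lemma heckeZE a (f : hecke) x : (a *: f) x = a * f x.
Proof. by rewrite ffunE. Qed.

Lemma hecke_sumE (c : 'S_n -> Qv) (F : 'S_n -> hecke) x :
  (\sum_y c y *: F y) x = \sum_y c y * F y x.
Proof. by rewrite sum_ffunE; apply: eq_bigr => y _; apply: heckeZE. Qed.

Definition expand P : hecke := \sum_x at_q (P x) *: T x.

Lemma expandE P x : expand P x = at_q (P x).
Proof.
rewrite /expand hecke_sumE (bigD1 x) //= big1 => [|y ne].
  by rewrite [T x x]ffunE eqxx addr0 mulr1.
by rewrite [T y x]ffunE eq_sym (negbTE ne) mulr0.
Qed.

Lemma CprimeE w P : (forall x, ~~ bruhat x w -> P x = 0) ->
  Cprime w P = v ^- len w *: expand P.
Proof.
move=> supp; rewrite /Cprime /expand big_mkcond; congr (_ *: _).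
apply: eq_bigr => x _; case: ifP => // /negbT/supp->.
by rewrite at_q0 scale0r.
Qed.

Lemma expandB P P' D : (forall x, D x = P x - P' x) ->
  expand D = expand P - expand P'.
Proof.
move=> defD; apply/ffunP => x.
apply: etrans (esym (heckeBE (expand P) (expand P') x)).
apply: etrans (expandE D x) _; rewrite defD at_qB.
by congr (_ - _); apply/esym/expandE.
Qed.

Lemma hecke_bar_expand_top P y : (forall z, P z != 0 -> (len z <= len y)%N) ->
  hecke_bar (expand P) y = bar (at_q (P y)) * q ^- len y.
Proof.
move=> max_y; rewrite hecke_bar_sum hecke_sumE (bigD1 y) //= big1 => [|z ne_zy].
  by rewrite hecke_bar_T_top // eqxx mul1r addr0.
have [-> | Pz_neq0] := eqVneq (P z) 0; first by rewrite at_q0 rmorph0 mul0r.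
by rewrite hecke_bar_T_top ?max_y // eq_sym (negbTE ne_zy) mul0r mulr0.
Qed.

(** The coefficient of the difference of two families at an element [y] of maximal
    length in its support satisfies the hypotheses of [bar_at_q_eq0] with
    [m = len w - len y]. *)
Lemma is_KL_unique w P P' : is_KL w P -> is_KL w P' -> P =1 P'.
Proof.
move=> [bar1 deg1 top1 supp1] [bar2 deg2 top2 supp2].
(* An opaque D keeps unification from unfolding the subtraction of polynomials. *)
have [D defD] : exists D : 'S_n -> {poly rat}, forall x, D x = P x - P' x.
  by exists (fun x => P x - P' x).
have barD : hecke_bar (v ^- len w *: expand D) = v ^- len w *: expand D.
  rewrite (CprimeE supp1) in bar1; rewrite (CprimeE supp2) in bar2.
  rewrite (expandB defD) scalerBr; apply: etrans (hecke_barB _ _) _.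
  exact: (congr2 (fun f g => f - g) bar1 bar2).
suff D0 x : D x = 0 by move=> x; apply/eqP; rewrite -subr_eq0 -defD D0.
apply/eqP/idPn => Dx_neq0.
case: (@arg_maxnP _ x (fun y => D y != 0) (@len n) Dx_neq0) => y Dy_neq0 max_y.
have le_yw : bruhat y w.
  by apply: contraNT Dy_neq0 => nle; rewrite defD supp1 // supp2 // subrr.
have ne_yw : y != w.
  by apply: contraNneq Dy_neq0 => ->; rewrite defD top1 top2 subrr.
have lt_yw := bruhat_len le_yw ne_yw.
case/negP: Dy_neq0; apply/eqP/(@bar_at_q_eq0 _ (len w - len y)).
  have := deg1 y le_yw ne_yw; have := deg2 y le_yw ne_yw.
  have le_sz : (size (D y) <= maxn (size (P y)) (size (P' y)))%N.
    by rewrite defD -(size_polyN (P' y)) size_polyD.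
  by move: le_sz lt_yw; lia.
have bar_y : bar (v ^- len w) * (bar (at_q (D y)) * q ^- len y)
    = v ^- len w * at_q (D y).
  rewrite -(hecke_bar_expand_top max_y) -(expandE D) -!heckeZE -hecke_barZ.
  exact: (congr1 (fun h : hecke => h y) barD).
rewrite fmorphV rmorphXn /= bar_v exprVn invrK in bar_y.
have vN := expf_neq0 (len w) v_neq0.
apply: etrans (esym (mulVKf vN _)) _; rewrite -bar_y.
have -> : (len w - len y).*2 = (len w + len w - len y * 2)%N by lia.
rewrite expfB_cond ?(negbTE v_neq0); last by lia.
have -> : q ^- len y = v ^- (len y * 2) by rewrite /q -exprM mulnC.
move: (bar _) => b; rewrite exprD -!mulrA; congr (_ * (_ * _)); exact: mulrC.
Qed.

Lemma KLpolyE w P : is_KL w P -> forall x, KLpoly x w = P x.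
Proof.
move=> KL_P; apply: is_KL_unique (KL_P).
exact: (epsilon_spec _ (is_KL w) (ex_intro _ P KL_P)).
Qed.

End Uniqueness.

(** * Multiplication by a block of two letters *)

Section RightFactor.
Set Implicit Arguments.
Unset Strict Implicit.
Import GroupScope GRing.Theory.
Local Open Scope ring_scope.

Variable n : nat.
Local Notation hecke := (hecke q n).
Local Notation T := (@T _ q n).
Implicit Types (f : hecke) (u w x y : 'S_n) (P : 'S_n -> {poly rat}) (i j : 'I_n.-1).

(** The family of coefficients after right multiplication by [1 + T (gen i)], as
    [expand_mul1T] shows; in this form it stays polynomial in [q]. *)
Definition mul1T i P x : {poly rat} :=
  if rascent x i then P x + 'X * P (x * gen i)%g else P (x * gen i)%g + 'X * P x.

Lemma mulr_1TE f i x : (f * (1 + T (gen i))) x =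
  if rascent x i then f x + q * f (x * gen i)%g else f (x * gen i)%g + q * f x.
Proof.
rewrite mulrDr mulr1 mulr_Tgen ffunE rmulE; case: ifP => // _.
by rewrite mulrBl mul1r addrCA; congr (_ + _); rewrite addrC subrK.
Qed.

Lemma expand_mul1T i P : expand (mul1T i P) = expand P * (1 + T (gen i)).
Proof.
apply/ffunP => x; rewrite mulr_1TE; apply: etrans (expandE _ x) _.
rewrite /mul1T (expandE P x) (expandE P (x * gen i)%g).
by case: ifP; rewrite at_qD at_qXM.
Qed.

Lemma mul1T_supp i P x : mul1T i P x != 0 -> P x != 0 \/ P (x * gen i)%g != 0.
Proof.
rewrite /mul1T; have [-> | ] := eqVneq (P x) 0; last by left.
have [-> | ] := eqVneq (P (x * gen i)%g) 0; last by right.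
by case: ifP; rewrite mulr0 addr0 eqxx.
Qed.

Lemma mul1T_bruhat i P w : rascent w i -> (forall x, P x != 0 -> bruhat x w) ->
  forall x, mul1T i P x != 0 -> bruhat x (w * gen i)%g.
Proof.
move=> asc supp x /mul1T_supp[] /supp le_w.
  exact: connect_trans le_w (bruhat_gen asc).
by rewrite -(mulKgen i x); apply: bruhat_mul_gen.
Qed.

(** A form of [is_KL] that is convenient for induction: as [size] is the degree plus
    one, the last inequality is the usual degree bound if [x != w], and for
    [x = w] it says that [P w] is constant, so that it holds on the whole support. *)
Definition KLdata w P : Prop :=
  [/\ hecke_bar (v ^- len w *: expand P) = v ^- len w *: expand P,
      forall x, P x != 0 -> bruhat x w,
      P w = 1
    & forall x, P x != 0 -> ((size (P x)).*2 + len x + (x != w) <= len w + 2)%N].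

Lemma KLdata_is_KL w P : KLdata w P -> is_KL w P.
Proof.
move=> [bar_P supp top deg].
have supp0 x : ~~ bruhat x w -> P x = 0.
  by move=> nle; apply/eqP; apply: contraNT nle => /supp.
split; [by rewrite (CprimeE supp0); exact: bar_P | | exact: top | exact: supp0].
move=> x le_xw ne_xw; have [-> | Px_neq0] := eqVneq (P x) 0; first by rewrite size_poly0.
by have := deg x Px_neq0; have := bruhat_len le_xw ne_xw; rewrite ne_xw; lia.
Qed.

Lemma bar_expand_mul1T i P c : hecke_bar (c *: expand P) = c *: expand P ->
  hecke_bar ((v^-1 * c) *: expand (mul1T i P)) = (v^-1 * c) *: expand (mul1T i P).
Proof.
move=> bar_P; rewrite expand_mul1T -scalerA scalerAl.
exact: hecke_bar_mul1T_gen bar_P.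
Qed.

End RightFactor.

Section Block.
Set Implicit Arguments.
Unset Strict Implicit.
Import GroupScope GRing.Theory.
Local Open Scope group_scope.

Variable n : nat.
Implicit Types (u w x y : 'S_n) (P : 'S_n -> {poly rat}).

(** The parabolic subgroup generated by the letters [s_1, ..., s_(m-1)], seen as the
    group of the permutations that fix the points of value at least [m]. *)
Definition fixes_from (m : nat) x : Prop := forall p : 'I_n, m <= p -> x p = p.

Lemma fixes_fromW m m' x : m <= m' -> fixes_from m x -> fixes_from m' x.
Proof. by move=> le_m fx p /(leq_trans le_m)/fx. Qed.

Lemma fixes_fromM m x y : fixes_from m x -> fixes_from m y -> fixes_from m (x * y).
Proof. by move=> fx fy p le_p; rewrite permM fx // fy. Qed.

Lemma fixes_fromV m x : fixes_from m x -> fixes_from m x^-1.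
Proof. by move=> fx p le_p; apply: (can_inj (permK x)); rewrite permKV fx. Qed.

Lemma fixes_from_lt m x (p : 'I_n) : fixes_from m x -> p < m -> x p < m.
Proof.
move=> fx lt_p; rewrite ltnNge; apply/negP => le_m.
by move: (lt_p); rewrite -(permK x p) (fixes_fromV fx le_m) ltnNge le_m.
Qed.

Lemma fixes_from_gen m (i : 'I_n.-1) : i.+1 < m -> fixes_from m (gen i).
Proof.
by move=> lt_i p le_p; rewrite genE tpermD // -val_eqE /= neq_ltn; apply/orP; left; lia.
Qed.

Variables (i j : 'I_n.-1) (def_j : j = i.+1 :> nat).
Let s := gen i.
Let t := gen j.
Let lo : 'I_n := Ordinal (gen_lt1 i).
Let mid : 'I_n := Ordinal (gen_lt1 j).
Let top : 'I_n := Ordinal (gen_lt2 j).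

Let s_lo : s lo = mid.
Proof. by rewrite /s gen_lo; apply: val_inj => /=; rewrite def_j. Qed.
Let s_mid : s mid = lo. Proof. by rewrite -s_lo /s -permM genK perm1. Qed.
Let s_top : s top = top.
Proof. by apply: (@fixes_from_gen j.+1) => //=; rewrite def_j. Qed.
Let t_mid : t mid = top. Proof. by rewrite /t gen_lo. Qed.
Let t_top : t top = mid. Proof. by rewrite /t gen_hi. Qed.
Let t_lo : t lo = lo.
Proof. by rewrite /t genE tpermD // -val_eqE /= def_j neq_ltn; apply/orP; right; lia. Qed.
Let hi_i : Ordinal (gen_lt2 i) = mid. Proof. by apply: val_inj; rewrite /= def_j. Qed.

Local Notation W := (fixes_from j.+1).

Let rasc_s x : rascent x i = (x^-1 lo < x^-1 mid).
Proof. by rewrite /rascent /ascent -/lo hi_i. Qed.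
Let rasc_t x : rascent x j = (x^-1 mid < x^-1 top).
Proof. by []. Qed.

(** [u * t] and [u * t * s] are longer than [u] because [t] and [t s] are minimal
    in their cosets of [W]. *)
Lemma W_ascent_t u : W u -> rascent u j.
Proof.
move=> /fixes_fromV Wu; rewrite rasc_t [u^-1 top]Wu //=.
exact: fixes_from_lt Wu _.
Qed.

Lemma W_ascent_ts u : W u -> rascent (u * t) i.
Proof.
move=> /fixes_fromV Wu; rewrite rasc_s invMg !permM /t Defs.genV -/t t_mid t_lo.
rewrite [u^-1 top]Wu //=; apply: (fixes_from_lt Wu); rewrite /= def_j; lia.
Qed.

(** As [t s t = s t s], conjugation by [t s] turns [t] into [s], and it preserves the
    order of the two points that they exchange. *)
Lemma ascent_tst w : rascent w i -> rascent (w * t * s) j.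
Proof.
rewrite rasc_s rasc_t !invMg !permM /s /t !Defs.genV -/s -/t.
by rewrite s_mid t_lo s_top t_top.
Qed.

Lemma W_s u : W u -> W (u * s).
Proof. by move=> Wu; apply/fixes_fromM/fixes_from_gen => //; rewrite def_j. Qed.

Lemma W_top u : W u -> u top = top. Proof. by apply. Qed.

Let mid_top : mid != top. Proof. by rewrite -val_eqE /= neq_ltn ltnSn. Qed.
Let lo_top : lo != top.
Proof. by rewrite -val_eqE /= def_j neq_ltn; apply/orP; left; lia. Qed.

Section Family.

Variable P : 'S_n -> {poly rat}.
Hypothesis supp_W : forall x, (P x != 0)%R -> W x.

Definition block_mul := mul1T i (mul1T j P).
Local Notation g := (mul1T j P).
Local Notation h := block_mul.

(* The three cosets W, W t and W t s are told apart by the image of top, which is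
   top, mid and lo, respectively. *)
Let P_out x : x top != top -> P x = 0%R.
Proof. by move=> ne; apply/eqP; apply: contraNT ne => /supp_W/W_top->. Qed.

Let g_in u : W u -> g u = P u.
Proof.
move=> Wu; rewrite /mul1T W_ascent_t // (@P_out (u * _)) ?mulr0 ?addr0 //.
by rewrite permM (W_top Wu) t_top.
Qed.

Let g_t u : W u -> g (u * t) = P u.
Proof.
move=> Wu; rewrite /mul1T rascent_gen W_ascent_t //= mulKgen.
by rewrite (@P_out (u * t)) ?mulr0 ?addr0 // permM (W_top Wu) t_top.
Qed.

Let g_out x : x top = lo -> g x = 0%R.
Proof.
move=> x_top; apply/eqP; apply/negPn/negP => /mul1T_supp[] /supp_W/W_top.
all: rewrite ?permM x_top.
  by move/eqP; rewrite (negbTE lo_top).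
by rewrite t_lo => /eqP; rewrite (negbTE lo_top).
Qed.

Let g_ts u : W u -> g (u * t * s) = 0%R.
Proof. by move=> Wu; rewrite g_out // !permM (W_top Wu) t_top s_mid. Qed.

Lemma block_t u : W u -> h (u * t) = P u.
Proof.
move=> Wu; rewrite /block_mul /mul1T W_ascent_ts // -!/(mul1T j P _).
by rewrite g_t // g_ts // mulr0 addr0.
Qed.

Lemma block_ts u : W u -> h (u * t * s) = P u.
Proof.
move=> Wu; rewrite /block_mul {1}/mul1T rascent_gen W_ascent_ts // mulKgen.
by rewrite g_t // g_ts // mulr0 addr0.
Qed.

Lemma block_in u : W u -> rascent u i -> h u = (P u + 'X * P (u * s))%R.
Proof.
by move=> Wu asc; rewrite /block_mul {1}/mul1T asc !g_in //; apply: W_s.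
Qed.

Lemma block_in_s u : W u -> rascent u i -> h (u * s) = (P u + 'X * P (u * s))%R.
Proof.
move=> Wu asc; rewrite /block_mul {1}/mul1T rascent_gen asc mulKgen !g_in //.
exact: W_s.
Qed.

(** After the factor [1 + T_t] the support is contained in [W] and [W t], so the
    support of the family is contained in [W], [W s], [W t] and [W t s];
    in [W = W s] every [x] is [u] or [u * s] for the shorter [u] of the two. *)
Lemma block_cases x : (h x != 0)%R -> exists2 u, W u &
  (x = u * t \/ x = u * t * s) /\ h x = P u \/
  [/\ rascent u i, x = u \/ x = u * s & h x = (P u + 'X * P (u * s))%R].
Proof.
have caseW u : W u -> exists2 u', W u' &
    [/\ rascent u' i, u = u' \/ u = u' * s & h u = (P u' + 'X * P (u' * s))%R].
  move=> Wu; have [asc | desc] := boolP (rascent u i).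
    by exists u; rewrite ?block_in //; split; [|left|].
  have asc : rascent (u * s) i by rewrite rascent_gen.
  have Ws := W_s Wu; have def_u : u = u * s * s by rewrite mulKgen.
  by exists (u * s) => //; split; [|right|rewrite {1}def_u block_in_s].
move=> hx; have : g x != 0%R \/ g (x * s) != 0%R by exact: mul1T_supp hx.
case=> /mul1T_supp[] /supp_W Wu.
- by have [u Wu' ?] := caseW x Wu; exists u => //; right.
- exists (x * t) => //; left; split; first by left; rewrite mulKgen.
  by rewrite -[in LHS](mulKgen j x) block_t.
- have [|u Wu' ?] := caseW x; first by rewrite -(mulKgen i x); apply: W_s.
  by exists u => //; right.
exists (x * s * t) => //; left; split; first by right; rewrite !mulKgen.
by rewrite -[in LHS](mulKgen i x) -[in LHS](mulKgen j (x * gen i)) block_ts.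
Qed.

Lemma block_fixes x : (h x != 0)%R -> fixes_from j.+2 x.
Proof.
have Ft : fixes_from j.+2 t by apply: fixes_from_gen.
have Fs : fixes_from j.+2 s by apply: fixes_from_gen; rewrite def_j.
case/block_cases=> u /(fixes_fromW (leqnSn _)) Fu.
case=> [[[]-> _]|[_ []-> _]]; by do ?apply: fixes_fromM.
Qed.

Variable w : 'S_n.
Hypotheses (KL_P : KLdata w P) (asc_w : rascent w i).

Let w_W : W w.
Proof. by case: KL_P => _ _ Pw _; apply: supp_W; rewrite Pw oner_neq0. Qed.

Lemma len_block : len (w * t * s) = (len w).+2.
Proof. by rewrite !rlen_asc ?W_ascent_ts ?W_ascent_t. Qed.

(** A block adds two to the length of [w], just enough for the factor [q] in the
    summand [q P (u s)].  At [x = u * s] this leaves no slack: the bound for [P]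
    at [u * s] is needed in its strict form, and [u * s != w] holds because
    [gen i] is an ascent of [w] and a descent of [u * s]. *)
Lemma block_deg x : (h x != 0)%R ->
  (size (h x)).*2 + len x + (x != w * t * s) <= len w + 4.
Proof.
case: KL_P => _ _ _ deg hx; have [u Wu] := block_cases hx.
have len_ut : len (u * t) = (len u).+1 by rewrite rlen_asc ?W_ascent_t.
have len_uts : len (u * t * s) = (len u).+2 by rewrite rlen_asc ?W_ascent_ts ?len_ut.
case=> [[def_x hxE] | [asc def_x hxE]]; last first.
  have len_us : len (u * s) = (len u).+1 by rewrite rlen_asc.
  have len_x : len x <= (len u).+1 by case: def_x => ->; rewrite ?len_us.
  suff : (size (h x)).*2 + len u <= len w + 2 by case: eqP; lia.
  have sz1 : P u != 0%R -> (size (P u)).*2 + len u <= len w + 2.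
    by move/deg; lia.
  have sz2 : P (u * s) != 0%R -> (size (P (u * s))).*2 + len u + 2 <= len w + 2.
    move=> Pus; have := deg _ Pus; rewrite len_us.
    have -> : u * s != w; last by lia.
    by apply: contraTneq asc_w => <-; rewrite rascent_gen asc.
  have := size_polyD (P u) ('X * P (u * s)); rewrite -hxE mulrC.
  have [Pus0 | Pus] := eqVneq (P (u * s)) 0%R.
    have /sz1 : P u != 0%R by move: hx; rewrite hxE Pus0 mulr0 addr0.
    by rewrite Pus0 mul0r size_poly0 maxn0; lia.
  rewrite size_mulX //.
  have [-> | /sz1] := eqVneq (P u) 0%R; last by move: (sz2 Pus); lia.
  by rewrite size_poly0; move: (sz2 Pus); lia.
have Pu : P u != 0%R by rewrite -hxE.
have := deg u Pu; rewrite hxE.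
case: def_x => ->; first by rewrite len_ut; case: eqP; case: eqP; lia.
rewrite len_uts (inj_eq (mulIg s)) (inj_eq (mulIg t)); case: eqP; lia.
Qed.

Lemma block_KL : KLdata (w * t * s) h.
Proof.
case: KL_P => bar_P supp Pw _; split.
- have -> : (v ^- len (w * t * s) = v^-1 * (v^-1 * v ^- len w))%R.
    by rewrite len_block !exprS !invfM.
  by do 2!apply: bar_expand_mul1T.
- apply: mul1T_bruhat (W_ascent_ts w_W) _.
  exact: mul1T_bruhat (W_ascent_t w_W) supp.
- by rewrite block_ts.
by move=> x /block_deg; rewrite len_block !addSnnS.
Qed.

End Family.
End Block.

(** * Words made of consecutive blocks *)

Section Word.
Set Implicit Arguments.
Unset Strict Implicit.
Import GroupScope GRing.Theory.
Local Open Scope group_scope.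

Definition blocks (k m : nat) : seq nat := flatten [seq [:: j; j.-1] | j <- iota k m].

Lemma blocksS k m : blocks k m.+1 = blocks k m ++ [:: k + m; (k + m).-1].
Proof. by rewrite /blocks -addn1 iotaD map_cat flatten_cat. Qed.

Lemma size_blocks k m : size (blocks k m) = m.*2.
Proof. by elim: m => // m IHm; rewrite blocksS size_cat IHm /= addn2. Qed.

Lemma mem_blocks k m i : i \in blocks k m -> k.-1 <= i < k + m.
Proof.
elim: m => // m IHm; rewrite blocksS mem_cat => /orP[/IHm|]; first by lia.
by rewrite !inE; lia.
Qed.

Lemma KLdata1 n : KLdata (1 : 'S_n) (fun x => ((x == 1%g)%:R)%R).
Proof.
split=> [|x||x].
- rewrite len1 expr0 invr1 scale1r.
  have -> : expand (fun x => ((x == 1%g)%:R)%R) = T q (1 : 'S_n).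
    apply/ffunP => x; apply: etrans (expandE _ x) _; rewrite ffunE.
    by case: eqP => _; rewrite ?at_q0 // /at_q rmorph1 tofrac1.
  by rewrite hecke_bar_T invg1 T1 invr1.
- by case: (eqVneq x 1) => [->|_]; rewrite ?bruhat_refl ?eqxx.
- by rewrite eqxx.
by case: (eqVneq x 1) => [->|_]; rewrite ?eqxx // size_poly1 len1.
Qed.

(** The invariant of the induction on the number [m] of blocks.  The next block begins
    with [s_(k+m)], and [gen i] with [i.+2 = k + m] is its second letter: the ascent [w < w * gen i] is the
    hypothesis of [block_deg], and the coefficient at [gen i] is the second
    entry of the Fibonacci recursion.  For [m = 0] that coefficient is
    [0], the value of [F_(-1)]. *)
Lemma blocks_KL n k m : 2 <= k -> k + m <= n ->
  exists P : 'S_n -> {poly rat}, let w := word_val n (blocks k m) in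
  [/\ KLdata w P,
      forall x, P x != 0%R -> fixes_from (k + m) x,
      len w = m.*2,
      P 1 = fib_q m
    & forall i : 'I_n.-1, i.+2 = k + m ->
        rascent w i /\ P (gen i) = if m is m'.+1 then fib_q m' else 0%R].
Proof.
move=> k_gt1; elim: m => [|m IHm] le_n.
  exists (fun x => ((x == 1%g)%:R)%R) => w.
  have -> : w = 1 by rewrite /w /word_val big_nil.
  split.
  - exact: KLdata1.
  - by move=> x; case: (eqVneq x 1) => [-> _ p _|_]; rewrite ?perm1 ?eqxx.
  - exact: len1.
  - by rewrite eqxx.
  move=> i _; split; first by rewrite /rascent invg1 /ascent !perm1 /=.
  by case: eqP => // e; have := len_gen i; rewrite e len1.
have [|P] := IHm; first by lia.
set w := word_val n _ => -[KL_P supp_P len_w P1 Ps].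
(* In gen, indices start at 0: the next block s_(k+m) s_(k+m-1) is gen j, gen i. *)
have lt_i : k + m - 2 < n.-1 by lia.
have lt_j : k + m - 1 < n.-1 by lia.
pose i := Ordinal lt_i; pose j := Ordinal lt_j.
have def_j : j = i.+1 :> nat by rewrite /=; lia.
have def_km : k + m = j.+1 by rewrite /=; lia.
have [asc_w P_s] := Ps i ltac:(rewrite /=; lia).
have def_w : word_val n (blocks k m.+1) = w * gen j * gen i.
  rewrite /word_val blocksS big_cat !big_cons big_nil /= mulg1 mulgA def_km.
  by rewrite /gen -def_j.
rewrite def_km in supp_P.
exists (block_mul i j P); rewrite def_w; split.
- exact: block_KL.
- by move=> x; rewrite addnS def_km; apply: (block_fixes def_j supp_P).
- by rewrite (len_block def_j supp_P KL_P) len_w.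
- rewrite (block_in def_j supp_P) ?mul1g //.
  - by rewrite P1 P_s; case: (m) => [|m'] //=; rewrite mulr0 addr0.
  - by move=> p _; rewrite perm1.
  by rewrite /rascent invg1 /ascent !perm1 /=.
move=> i' def_i'; have -> : i' = j by apply: val_inj; rewrite /= in def_i' *; lia.
split; first exact: ascent_tst.
by rewrite -[gen j]mul1g (block_t def_j supp_P) // => p _; rewrite perm1.
Qed.

End Word.

Local Open Scope nat_scope.

Theorem corollary2 (n k l : nat) (hk : 2 <= k) (hkl : k < l) (hln : l < n) :
  reduced n (word_kl k l) /\
  KLpoly 1%g (word_val n (word_kl k l)) = fib_q (l - k + 1).
Proof.
have -> : word_kl k l = blocks k (l - k + 1) by rewrite addn1.
have [|P [KL_P _ len_w P1 _]] := @blocks_KL n k (l - k + 1) hk; first by lia.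
split; last by rewrite (KLpolyE (KLdata_is_KL KL_P)).
split; last by rewrite len_w size_blocks.
by apply/allP => i /mem_blocks; lia.
Qed.
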